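(* In RapidChain with $n$ parties, $m$ shards, at most $pn$ corrupted parties and per-shard consensus resilience $a$, the throughput factor is $$\sigma=\mu\cdot\tau\cdot\frac{m}{v}<\frac{\mu\cdot\tau\cdot f(n)}{v},\qquad f(n)=\frac{n}{c'\log\left(\frac{n}{c'\log n}\right)},$$ where $c'=c/p$ and $c$ is a constant such that $pn=c\,m\log m$ and $\frac{c}{d_c}>\frac{p}{a}$, with $d_c$ the solution $x>c$ of $1+x(\log c-\log x+1)-c=0$.
   Context: Transactions spend unspent transaction outputs (UTXOs) and create new ones; $v$ is the average number of inputs and outputs of a transaction in the input transaction set $T$. Each shard runs a consensus protocol with chain growth parameter $\tau$ (for any honest party, in any $s$ rounds at least $\tau s$ blocks are added to its chain) and chain quality parameter $\mu$ (among any $l$ consecutive blocks of an honest party's chain the ratio of honest blocks is at least $\mu$). $a$ is the resilience of the consensus protocol: a shard is secure if at least a fraction $1-a$ of its parties is honest; $p$ is the fraction of corrupted parties in the whole system ($p<a$; in RapidChain $p<1/3$, $a=1/2$). Degree of parallelism: $m'=\frac{|T|\,m}{\sum_{j=1}^{|T|}\sum_{i=1}^{m}m_{i,j}}$, where $m_{i,j}=1$ if the $j$-th transaction of $T$ has an input or an output assigned to the $i$-th shard and $m_{i,j}=0$ otherwise. Throughput factor: $\sigma=\mu\cdot\tau\cdot m'$ (average number of blocks processed per round); with transactions spread uniformly the expected $m'$ is taken to be $m/v$. RapidChain: the $n$ parties are partitioned uniformly at random into $m$ shards and all shards must be secure with probability $1-o(1)$; transactions are assigned to shards by the prefix of their ID.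 For a cross-shard transaction the leader of the output shard creates one ''dummy'' transaction per input UTXO, moving the input to the output shard, and then the transaction is executed in the output shard; at most $v$ shards are affected per transaction.
   Formalization: The strict bound is claimed only when m<n and n/(c' log n)>1, or for all large n (it fails at n=m); and ''spread uniformly'' means transaction j affects each shard with probability v_j/m, so v_j distinct shards almost surely, since under independent hashing the expected m' is not exactly m/v. *)

(* Defs.v *)
From HB Require Import structures.
From mathcomp Require Import all_boot all_order all_algebra.
From mathcomp Require Import all_classical all_reals all_analysis.
Set Implicit Arguments.
Unset Strict Implicit.
Unset Printing Implicit Defensive.
Import Order.TTheory GRing.Theory Num.Theory.
Import numFieldNormedType.Exports.
Local Open Scope ring_scope.

Record transaction (U : finType) := Transaction {
  tx_in : {set U};
  tx_out : {set U};
  tx_fresh : [disjoint tx_in & tx_out];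
  tx_outN0 : tx_out != finset.set0
}.

Definition tx_utxos (U : finType) (t : transaction U) : {set U} :=
  tx_in t :|: tx_out t.

(* One instance of the protocol. Randomness enters twice: the partition of the
   parties, [{ffun 'I_n -> 'I_m}] under the uniform law, and the assignment of
   UTXOs to shards, [{ffun utxo -> 'I_m}] under the law [law].
   [chain pi i P r] is the chain held by party P in the consensus protocol of
   shard i after round r, when the parties are partitioned by pi; a block is
   represented by the party that produced it. *)
Record system (R : realType) := System {
  n_parties : nat;
  n_shards : nat;
  corrupted : {set 'I_n_parties};
  chain : {ffun 'I_n_parties -> 'I_n_shards} -> 'I_n_shards ->
          'I_n_parties -> nat -> seq 'I_n_parties;
  utxo : finType;
  n_tx : nat;
  n_tx_gt0 : (0 < n_tx)%N;
  txs : 'I_n_tx -> transaction utxo;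
  law : {ffun utxo -> 'I_n_shards} -> R;
  law_ge0 : forall h, 0 <= law h;
  law_sum1 : \sum_h law h = 1
}.

Section System.
Context {R : realType}.
Implicit Types (S : system R) (a mu tau : R).

Definition members S (pi : {ffun 'I_(n_parties S) -> 'I_(n_shards S)})
    (i : 'I_(n_shards S)) : {set 'I_(n_parties S)} :=
  [set P | pi P == i].

Definition secure a S (pi : {ffun 'I_(n_parties S) -> 'I_(n_shards S)})
    (i : 'I_(n_shards S)) : bool :=
  (1 - a) * #|members pi i|%:R <= #|members pi i :\: corrupted S|%:R.

Definition prob_all_secure a S : R :=
  #|[set pi : {ffun 'I_(n_parties S) -> 'I_(n_shards S)}
      | [forall i, secure a pi i]]|%:R /
  #|{ffun 'I_(n_parties S) -> 'I_(n_shards S)}|%:R.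

Definition chain_growth tau (s : nat) S
    (pi : {ffun 'I_(n_parties S) -> 'I_(n_shards S)}) (i : 'I_(n_shards S)) :=
  forall P r, P \in members pi i :\: corrupted S ->
    (size (chain pi i P r))%:R + tau * s%:R
      <= (size (chain pi i P (r + s)))%:R :> R.

Definition chain_quality mu (l : nat) S
    (pi : {ffun 'I_(n_parties S) -> 'I_(n_shards S)}) (i : 'I_(n_shards S)) :=
  forall P r w, P \in members pi i :\: corrupted S ->
    infix w (chain pi i P r) -> size w = l ->
    mu <= (count (fun Q => Q \notin corrupted S) w)%:R / l%:R.

Definition shard_consensus a mu tau (s l : nat) S :=
  forall (pi : {ffun 'I_(n_parties S) -> 'I_(n_shards S)}) i, secure a pi i ->
    chain_growth tau s pi i /\ chain_quality mu l pi i.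

(* m_(i,j). The dummy transactions executing transaction j move its inputs from
   the shards of these inputs to the output shard, so they touch no other
   shard. *)
Definition touches S (h : {ffun utxo S -> 'I_(n_shards S)})
    (i : 'I_(n_shards S)) (j : 'I_(n_tx S)) : bool :=
  [exists u in tx_utxos (txs j), h u == i].

Definition dop S (h : {ffun utxo S -> 'I_(n_shards S)}) : R :=
  (n_tx S * n_shards S)%:R / (\sum_j \sum_i touches h i j)%:R.

Definition expected_dop S : R := \sum_h law (s := S) h * dop h.

Definition throughput mu tau S : R := mu * tau * expected_dop S.

(* v: average over T of the number of inputs and outputs. *)
Definition avg_utxos S : R :=
  (\sum_(j < n_tx S) #|tx_utxos (txs j)|)%:R / (n_tx S)%:R.

(* Transaction j, which has v_j inputs and outputs, affects each shard with
   probability v_j / m; equivalently, in addition to shards being equally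
   likely to be affected, it affects almost surely v_j shards, the largest
   possible number. *)
Definition uniformly_spread S :=
  forall (i : 'I_(n_shards S)) (j : 'I_(n_tx S)),
    \sum_(h | touches h i j) law (s := S) h
      = #|tx_utxos (txs j)|%:R / (n_shards S)%:R.

End System.

(* f(n), with c' as a parameter; [ln] is the natural logarithm and is 0 on
   nonpositive arguments, so this is meaningful when n / (c' ln n) > 1. *)
Definition shard_bound {R : realType} (c' : R) (n : nat) : R :=
  n%:R / (c' * ln (n%:R / (c' * ln n%:R))).

Definition is_dc {R : realType} (c d : R) : Prop :=
  c < d /\ 1 + d * (ln c - ln d + 1) - c = 0.

(* Main.v *)
(* Uniform spreading forces transaction j to meet v_j shards on average, which is
   also the largest possible number of shards it can meet; hence it meets exactly
   v_j shards almost surely, and m' = m / v almost surely. As for the bound,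
   n = c' m log m and m < n give n / (c' log n) = m log m / log n < m, so that
   f(n) > n / (c' log m) = m. For large n the condition m < n holds because
   log m <= 1/c' would give n = c' m log m <= exp(1/c'). *)
Require Import Defs.
From mathcomp Require Import all_boot all_order all_algebra.
From mathcomp Require Import all_classical all_reals all_analysis.
Import Order.TTheory GRing.Theory Num.Theory.
Import numFieldNormedType.Exports.
Local Open Scope classical_set_scope.
Local Open Scope ring_scope.

Section ExpectedParallelism.
Context {R : realType} (S : system R).
Local Notation assignment := {ffun utxo S -> 'I_(n_shards S)}.
Implicit Types (h : assignment) (j : 'I_(n_tx S)).

(** The shards touched by transaction [j] form the image of its UTXO set under [h]. *)
Lemma sum_touches_le h j :
  (\sum_i touches h i j <= #|tx_utxos (txs j)|)%N.
Proof.
apply: leq_trans (leq_imset_card h _).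
rewrite -sum1_card [leqRHS]big_mkcond /=; apply: leq_sum => i _.
case: ifP => [_|/negP]; first exact: leq_b1.
apply: contra_notT; rewrite -ltnNge lt0b => /exists_inP[u ut /eqP <-].
exact: imset_f.
Qed.

Lemma tx_utxos_gt0 j : (0 < #|tx_utxos (txs j)|)%N.
Proof.
have /finset.set0Pn[u uo] := tx_outN0 (txs j).
by apply/card_gt0P; exists u; rewrite finset.inE uo orbT.
Qed.

Lemma avg_utxos_gt0 : 0 < avg_utxos S.
Proof.
rewrite divr_gt0 ?ltr0n ?n_tx_gt0// (bigD1 (Ordinal (n_tx_gt0 S)))//=.
by rewrite addn_gt0 tx_utxos_gt0.
Qed.

(** Some transaction exists and has an output, whose image under [h] is a shard. *)
Lemma n_shards_gt0 h : (0 < n_shards S)%N.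
Proof.
have /card_gt0P[u _] := tx_utxos_gt0 (Ordinal (n_tx_gt0 S)).
exact: leq_ltn_trans (ltn_ord (h u)).
Qed.

Lemma sum_touches_as h j : uniformly_spread S -> law h != 0 ->
  (\sum_i touches h i j)%N = #|tx_utxos (txs j)|.
Proof.
move=> spread law_h; set v := #|tx_utxos (txs j)|.
have m_neq0 : (n_shards S)%:R != 0 :> R by rewrite pnatr_eq0 -lt0n n_shards_gt0.
have gap_ge0 h' : true -> 0 <= law h' * (v%:R - (\sum_i touches h' i j)%:R).
  by move=> _; rewrite mulr_ge0 ?law_ge0// subr_ge0 ler_nat sum_touches_le.
(* Linearity of expectation: each of the [m] shards contributes [v / m] by [spread]. *)
have mean : \sum_h' law h' * (\sum_i touches h' i j)%:R = v%:R.
  under eq_bigr do rewrite natr_sum mulr_sumr.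
  rewrite exchange_big /= (eq_bigr (fun=> v%:R / (n_shards S)%:R)).
    by rewrite sumr_const card_ord -[LHS]mulr_natr divfK.
  move=> i _; rewrite -(spread i) [RHS]big_mkcond; apply: eq_bigr => h' _.
  by case: touches; rewrite (mulr1, mulr0).
(* The gap to the maximum is nonnegative with mean zero, so it vanishes wherever [law] does not. *)
have /psumr_eq0P : \sum_h' law h' * (v%:R - (\sum_i touches h' i j)%:R) = 0.
  under eq_bigr do rewrite mulrBr.
  by rewrite sumrB -mulr_suml law_sum1 mean mul1r subrr.
move=> /(_ gap_ge0 h isT)/eqP; rewrite mulf_eq0 (negbTE law_h)/= subr_eq0.
by rewrite eqr_nat => /eqP.
Qed.

Lemma expected_dopE : uniformly_spread S ->
  expected_dop S = (n_shards S)%:R / avg_utxos S.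
Proof.
move=> spread.
transitivity (\sum_(h : assignment) law h * ((n_shards S)%:R / avg_utxos S)); last first.
  by rewrite -mulr_suml law_sum1 mul1r.
apply: eq_bigr => h _.
(* [dop h] is only known on the support of [law]; elsewhere both terms are zero. *)
have [->|law_h] := eqVneq (law h) 0; first by rewrite !mul0r.
congr (_ * _); rewrite /dop /avg_utxos invf_div mulrA -natrM mulnC.
by congr (_ / _%:R); apply: eq_bigr => j _; rewrite sum_touches_as.
Qed.

End ExpectedParallelism.

Lemma lt_shard_bound {R : realType} (C : R) (m n : nat) : 0 < C ->
  n%:R = C * m%:R * ln m%:R -> (m < n)%N -> 1 < n%:R / (C * ln n%:R) ->
  m%:R < shard_bound C n.
Proof.
move=> C_gt0 nE m_lt_n ratio_gt1.
have n_gt0 : (0 : R) < n%:R by rewrite ltr0n (leq_ltn_trans _ m_lt_n).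
have m_gt0 : (0 : R) < m%:R.
  rewrite lt0r ler0n andbT; apply: contraTneq n_gt0 => m0.
  by rewrite nE m0 mulr0 mul0r ltxx.
have lnm_gt0 : 0 < ln m%:R :> R by move: n_gt0; rewrite nE pmulr_rgt0// mulr_gt0.
have lnmn : ln m%:R < ln n%:R :> R by rewrite ltr_ln ?posrE// ltr_nat.
have lnn_gt0 : 0 < ln n%:R :> R := lt_trans lnm_gt0 lnmn.
have ratio_lt : n%:R / (C * ln n%:R) < m%:R :> R.
  by rewrite ltr_pdivrMr ?mulr_gt0// mulrCA {1}nE -mulrA ltr_pM2l// ltr_pM2l.
(* [ratio_gt1] makes the outer logarithm positive, which allows clearing the denominator. *)
rewrite /shard_bound ltr_pdivlMr; last by rewrite mulr_gt0// ln_gt0.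
rewrite [ltRHS]nE mulrA [m%:R * C]mulrC ltr_pM2l ?mulr_gt0//.
by rewrite ltr_ln ?posrE// (lt_trans ltr01).
Qed.

(** The threshold bears on [C * x * ln x], which will be the number of parties, because that is the
    quantity assumed to grow. If [ln x] exceeds [C^-1], the factor [C * ln x] exceeds 1; otherwise
    [x] is at most [expR C^-1]. *)
Lemma lt_mul_ln {R : realType} (C x : R) : 0 < C -> 0 <= x ->
  expR C^-1 < C * x * ln x -> x < C * x * ln x.
Proof.
move=> C_gt0; rewrite le0r => /predU1P[->|x_gt0].
  by rewrite mulr0 mul0r ltNge expR_ge0.
have [lnx _|lnx big] := ltP C^-1 (ln x).
  by rewrite mulrAC ltr_pMl// -ltr_pdivrMl// mulr1.
by apply: le_lt_trans big; rewrite -[leLHS]lnK ?posrE// ler_expR.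
Qed.

Lemma ln_lt_linear {R : realType} (C x : R) : 0 < C -> 1 < x ->
  4 * C ^+ 2 < x -> 1 < x / (C * ln x).
Proof.
move=> C_gt0 x_gt1 x_gt; have x_gt0 : 0 < x := lt_trans ltr01 x_gt1.
rewrite ltr_pdivlMr ?mul1r ?mulr_gt0 ?ln_gt0// mulrC -ltr_pdivlMr//.
rewrite -ltr_expR lnK ?posrE//.
(* The goal is now [x < expR (x / C)]. Halving the exponent gives [expR y] squared, above
   [y * y = x ^+ 2 / (4 * C ^+ 2)]; this exceeds [x] exactly when [x] exceeds [4 * C ^+ 2]. *)
set y := x / (2 * C).
have y_gt0 : 0 < y by rewrite divr_gt0// mulr_gt0.
have -> : x / C = y + y.
  by rewrite /y invfM [2^-1 * _]mulrC mulrA -splitr.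
rewrite expRD; apply: (@lt_trans _ _ (y * y)).
  rewrite /y mulrACA -invfM ltr_pdivlMr ?mulr_gt0// ltr_pM2l//.
  by rewrite mulrACA -natrM -expr2.
by rewrite ltr_pM ?ltW// (lt_le_trans _ (expR_ge1Dx _))// ltrDr.
Qed.

Theorem theorem54 (R : realType) (S : nat -> system R)
  (p a c d mu tau : R) (s l : nat)
  (p_gt0 : 0 < p) (p_lt_a : p < a) (a_lt1 : a < 1)
  (mu_gt0 : 0 < mu) (tau_gt0 : 0 < tau) (s_gt0 : (0 < s)%N) (l_gt0 : (0 < l)%N)
  (c_gt0 : 0 < c) (dc : is_dc c d) (c_dc : p / a < c / d)
  (parties_infty : ((n_parties (S k))%:R : R) @[k --> \oo] --> +oo)
  (corruption : forall k,
    #|corrupted (S k)|%:R <= p * (n_parties (S k))%:R)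
  (pn_eq : forall k,
    p * (n_parties (S k))%:R = c * (n_shards (S k))%:R * ln (n_shards (S k))%:R)
  (whp_secure : prob_all_secure a (S k) @[k --> \oo] --> (1 : R))
  (consensus : forall k, shard_consensus a mu tau s l (S k))
  (spread : forall k, uniformly_spread (S k)) :
  (forall k, let n := n_parties (S k) in let m := n_shards (S k) in
     throughput mu tau (S k) = mu * tau * (m%:R / avg_utxos (S k)) /\
     ((m < n)%N -> 1 < n%:R / (c / p * ln n%:R) ->
      mu * tau * (m%:R / avg_utxos (S k))
        < mu * tau * shard_bound (c / p) n / avg_utxos (S k))) /\
  (\forall k \near \oo,
     throughput mu tau (S k)
       < mu * tau * shard_bound (c / p) (n_parties (S k)) / avg_utxos (S k)).
Proof.
have C_gt0 : 0 < c / p by rewrite divr_gt0.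
have nE k : (n_parties (S k))%:R
    = c / p * (n_shards (S k))%:R * ln (n_shards (S k))%:R.
  apply: (mulfI (lt0r_neq0 p_gt0)); rewrite pn_eq !mulrA.
  by rewrite [p * c]mulrC mulfK// lt0r_neq0.
have throughputE k : throughput mu tau (S k)
    = mu * tau * ((n_shards (S k))%:R / avg_utxos (S k)).
  by rewrite /throughput expected_dopE.
have bound k : (n_shards (S k) < n_parties (S k))%N ->
    1 < (n_parties (S k))%:R / (c / p * ln (n_parties (S k))%:R) ->
    mu * tau * ((n_shards (S k))%:R / avg_utxos (S k))
      < mu * tau * shard_bound (c / p) (n_parties (S k)) / avg_utxos (S k).
  move=> m_lt_n ratio; rewrite mulrA ltr_pM2r ?invr_gt0 ?avg_utxos_gt0//.
  by rewrite ltr_pM2l ?mulr_gt0// lt_shard_bound.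
split=> [k|]; first by split; [exact: throughputE|exact: bound].
(* Both side conditions follow from lower bounds on the number of parties: [expR (c / p)^-1] for the
   first, [1] and [4 * (c / p) ^+ 2] for the second. *)
near=> k; rewrite throughputE; apply: bound.
  rewrite -(ltr_nat R) nE lt_mul_ln// -nE.
  by near: k; move/cvgryPgt: parties_infty; exact.
apply: ln_lt_linear => //; near: k; move/cvgryPgt: parties_infty; exact.
Unshelve. all: by end_near.
Qed.
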